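(* Let $X$ be any domain and let $\mathcal{H}\subseteq 2^X$ be a hypothesis class over $X$ with finite VC dimension. A concept $c\subseteq X$ is uniformly interpretable by $\mathcal{H}$ (at a constant depth) if and only if $c\in\bigcup_{d=1}^\infty \mathrm{clos}(\mathrm{Alg}_d(\mathcal{H}))$.
   Context: Fix a $\sigma$-algebra on $X$; $\mathcal{P}(X)$ is the set of all probability distributions on $X$ with this $\sigma$-algebra. All concepts and hypotheses (subsets of $X$, identified with their indicator functions $X\to\{0,1\}$) are assumed measurable. The standard measurability conditions are assumed under which the Vapnik–Chervonenkis uniform convergence theorem applies; in particular, it applies under every $P\in\mathcal{P}(X)$ to every class of finite VC dimension consisting of sets $T\triangle c$, with $T$ ranging over a subfamily of the classifiers computed by the $\mathcal{H}$-based decision trees defined next. An $\mathcal{H}$-based decision tree is a finite full binary tree $T$ in which every leaf holds a label in $\{0,1\}$ and every internal node $v$ holds a function $f_v\in\mathcal{H}$; a point $x$ is routed from the root to a leaf, going at node $v$ to the child determined by $f_v(x)$, and $T(x)$ is the label of the leaf reached. $\mathrm{depth}(T)$ is the height of $T$ (a single leaf has depth $0$). $\mathrm{Alg}_d(\mathcal{H})$ is the family of all subsets of $X$ (equivalently, classifiers $X\to\{0,1\}$) computed by $\mathcal{H}$-based decision trees of depth at most $d$. For a family $\mathcal{G}$ of subsets of $X$, $$\mathrm{clos}(\mathcal{G})=\{h\subseteq X:\ \forall P\in\mathcal{P}(X)\ \exists h_1,h_2,\ldots\in\mathcal{G}\ \text{such that}\ \lim_{n\to\infty}P(h\triangle h_n)=0\}.$$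 $c$ is uniformly interpretable by $\mathcal{H}$ if there is a function $f':(0,1]\to\mathbb{N}$ such that for all $P\in\mathcal{P}(X)$ and all $0<\varepsilon\le1$ there is an $\mathcal{H}$-based decision tree $T$ with $\mathrm{depth}(T)\le f'(\varepsilon)$ and $\Pr_{x\sim P}(T(x)\neq c(x))\le\varepsilon$. It is so at a constant depth if $f'$ can be taken to be a constant function. The equivalence is claimed for uniform interpretability, and the parenthetical indicates that for such $\mathcal{H}$ it is the same as uniform interpretability at constant depth. *)

(* Defs.v *)
From HB Require Import structures.
From mathcomp Require Import all_boot all_order all_algebra.
From mathcomp Require Import all_classical all_reals all_analysis.
Import Order.TTheory GRing.Theory Num.Theory.
Import numFieldNormedType.Exports.

Set Implicit Arguments.
Unset Strict Implicit.
Unset Printing Implicit Defensive.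

Local Open Scope classical_set_scope.
Local Open Scope ring_scope.

(* Concepts and hypotheses on X are sets A : set X, identified with the
   indicator x |-> (x \in A). *)

Definition shatters (X : Type) (C : set (set X)) (S : set X) : Prop :=
  forall B, B `<=` S -> exists2 A, C A & A `&` S = B.

Definition finite_VC_dim (X : Type) (C : set (set X)) : Prop :=
  exists k : nat, forall (S : set X) (n : nat),
    (S #= `I_n)%card -> shatters C S -> (n <= k)%N.

Inductive dtree (X : Type) : Type :=
  | Leaf of bool
  | Node of set X & dtree X & dtree X.
Arguments Leaf {X} _.

Fixpoint depth (X : Type) (T : dtree X) : nat :=
  match T with
  | Leaf _ => 0
  | Node _ T0 T1 => (maxn (depth T0) (depth T1)).+1
  end.

Fixpoint based (X : Type) (H : set (set X)) (T : dtree X) : Prop :=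
  match T with
  | Leaf _ => True
  | Node f T0 T1 => [/\ H f, based H T0 & based H T1]
  end.

Fixpoint eval (X : Type) (T : dtree X) (x : X) : bool :=
  match T with
  | Leaf b => b
  | Node f T0 T1 => if x \in f then eval T1 x else eval T0 x
  end.

Definition concept_of (X : Type) (T : dtree X) : set X := [set x | eval T x].

Definition Alg (X : Type) (H : set (set X)) (k : nat) : set (set X) :=
  [set concept_of T | T in [set T | based H T /\ (depth T <= k)%N]].

Definition clos (R : realType) (d : measure_display) (X : measurableType d)
    (G : set (set X)) : set (set X) :=
  [set h | measurable h /\
    forall P : probability X R, exists h_ : nat -> set X,
      (forall n, G (h_ n)) /\ P (h `+` h_ n) @[n --> \oo] --> 0%E].

(* Only the values f' e for 0 < e <= 1 are constrained. *)
Definition interpretable_within (R : realType) (d : measure_display)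
    (X : measurableType d) (H : set (set X)) (c : set X) (f' : R -> nat) :
    Prop :=
  forall (P : probability X R) (e : R), 0 < e -> e <= 1 ->
    exists T : dtree X, [/\ based H T, (depth T <= f' e)%N &
      (P [set x | eval T x != (x \in c)] <= e%:E)%E].

Definition uniformly_interpretable (R : realType) (d : measure_display)
    (X : measurableType d) (H : set (set X)) (c : set X) : Prop :=
  exists f' : R -> nat, interpretable_within H c f'.

Definition uniformly_interpretable_at_constant_depth (R : realType)
    (d : measure_display) (X : measurableType d) (H : set (set X))
    (c : set X) : Prop :=
  exists k : nat, @interpretable_within R d X H c (fun=> k).

Section iid_law.
Context (R : realType) (d : measure_display) (X : measurableType d).

Definition cons_sample (n : nat) (z : X * n.-tuple X) : n.+1.-tuple X :=
  [tuple of z.1 :: z.2].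

Lemma measurable_cons_sample (n : nat) : measurable_fun setT (@cons_sample n).
Proof.
apply: measurable_cons; [exact: measurable_fst|exact: measurable_snd].
Qed.

HB.instance Definition _ (n : nat) :=
  isMeasurableFun.Build _ _ _ _ (@cons_sample n) (@measurable_cons_sample n).

(* The law P^n of n independent draws from P. *)
Fixpoint iid_law (P : probability X R) (n : nat) :
    probability (n.-tuple X) R :=
  match n with
  | 0 => \d_([tuple] : 0.-tuple X)
  | m.+1 => distribution (P \x iid_law P m)%E (@cons_sample m)
  end.

Lemma iid_lawE (P : probability X R) (n : nat) (A : 'I_n -> set X) :
  (forall i, measurable (A i)) ->
  iid_law P n [set s | forall i, A i (tnth s i)] =
    (\prod_(i < n) P (A i))%E.
Proof.
elim: n A => [|n IH] A mA.
  by rewrite big_ord0 /= diracE mem_set //=; case.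
rewrite big_ord_recl -(IH (fun i => A (lift ord0 i)))//.
rewrite -[LHS]/((P \x iid_law P n)%E (@cons_sample n @^-1` _)).
rewrite -product_measure1E//.
  congr (_ _); apply/seteqP; split => -[x s] /=.
    move=> h; split => /=; first exact: (h ord0).
    by move=> i; have := h (lift ord0 i); rewrite tnthS.
  move=> [h0 h] i; case: (unliftP ord0 i) => [j|] -> //.
  by rewrite tnthS; exact: h.
rewrite (_ : [set s | _] = \bigcap_(i in setT)
    ((fun s : n.-tuple X => tnth s i) @^-1` (A (lift ord0 i)))).
  apply: fin_bigcap_measurable => //= i _.
  by rewrite -[X in measurable X]setTI; exact: (@measurable_tnth _ _ _ i).
by apply/seteqP; split => s /= h i; [move=> _|]; apply: h.
Qed.

End iid_law.

Definition empirical (R : realType) (X : Type) (n : nat) (s : n.-tuple X)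
    (A : set X) : R := (count (fun x => x \in A) s)%:R / n%:R.

(* The conclusion of the Vapnik-Chervonenkis theorem for the class C under P:
   sup_(A in C) |P_n(A) - P(A)| tends to 0 in P^n-probability. The event
   that the supremum exceeds e is measured by its outer P^n-probability,
   through a measurable superset E. *)
Definition uniform_convergence (R : realType) (d : measure_display)
    (X : measurableType d) (P : probability X R) (C : set (set X)) : Prop :=
  forall e delta : R, 0 < e -> 0 < delta ->
    exists n0 : nat, forall n : nat, (n0 <= n)%N ->
      exists E : set (n.-tuple X), [/\ measurable E,
        (iid_law P n E <= delta%:E)%E &
        forall s, ~ E s ->
          forall A, C A -> `|empirical R s A - fine (P A)| <= e].

(* The standing measurability convention: the Vapnik-Chervonenkis theorem
   applies to the classes {T triangle c | T in G} of finite VC dimension, G a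
   family of classifiers computed by H-based decision trees. *)
Definition VC_theorem_applies (R : realType) (d : measure_display)
    (X : measurableType d) (H : set (set X)) (c : set X) : Prop :=
  forall (P : probability X R) (G : set (set X)),
    G `<=` \bigcup_k Alg H k ->
    finite_VC_dim [set T `+` c | T in G] ->
    uniform_convergence P [set T `+` c | T in G].

(* Main.v *)
Require Import Defs.

(* Take for d the depth that suffices for error 2^-9. Boosting depth-d trees on
   a finite sample gives a list of trees of which each sample point is
   misclassified by fewer than one in eight; hence two sample points with
   different labels are told apart by at least three quarters of the list. The
   sets {trees telling x and y apart} form a system whose traces on n trees are
   polynomially many (Sauer-Shelah for the dual class), so by the epsilon-net
   theorem a number of trees that depends neither on the sample nor on the
   length of the list already tells all such pairs apart. The label of a sample
   point is then a function of the answers of these few trees, i.e. a tree of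
   constant depth agrees with c on the sample. On a sample for which uniform
   convergence holds, such a tree also has small error under P. *)

From mathcomp Require Import all_boot.

Set Implicit Arguments.
Unset Strict Implicit.
Unset Printing Implicit Defensive.

(** * Exponentials outgrow polynomials *)

Lemma exp2_dominates (a b : nat) :
  exists K, forall n, K <= n -> (b * n.+1) ^ a < 2 ^ n.
Proof.
exists (((b * a.+1.*2) ^ a).*2) => n Kn.
have a0 : 0 < a.+1.*2 by rewrite doubleS.
(* Up to the factor [a.+1.*2], [n.+1] is at most [2 ^ u], whose [a]-th power uses only half of the
   exponent [n]; the other half absorbs the constants, which is what the choice of the threshold
   ensures. *)
set u := n %/ a.+1.*2.
have un : n.+1 <= a.+1.*2 * 2 ^ u.
  apply: (@leq_trans (a.+1.*2 * u.+1)); last by rewrite leq_mul2l ltn_expl ?orbT.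
  by rewrite mulnC -ltn_divLR.
have ua : u * a <= n./2.
  rewrite -[n./2](@mulnK _ 2) // -divn2.
  have : u * a.+1.*2 <= n by exact: leq_divM.
  rewrite -!muln2 => h; rewrite mulnK // leq_divRL //.
  by apply: leq_trans h; rewrite mulnA leq_mul2r leq_mul2l leqnSn !orbT.
apply: (@leq_ltn_trans ((b * a.+1.*2) ^ a * 2 ^ n./2)).
  apply: (@leq_trans ((b * (a.+1.*2 * 2 ^ u)) ^ a)).
    by case: (posnP a) => [->|a1] //; rewrite leq_exp2r // leq_mul2l un orbT.
  by rewrite mulnA expnMn -expnM leq_mul2l leq_exp2l // ua orbT.
apply: (@leq_trans (2 ^ n./2 * 2 ^ n./2)); last first.
  by rewrite -expnD leq_exp2l // addnn -[X in _ <= X]odd_double_half leq_addl.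
rewrite ltn_mul2r expn_gt0 /=.
have : (b * a.+1.*2) ^ a <= n./2 by rewrite -[X in X <= _]doubleK half_leq.
by move=> h; apply: (leq_ltn_trans h); rewrite ltn_expl.
Qed.

(** * The Sauer-Shelah lemma *)

Section Pajor.
Variable I : finType.
Implicit Types (F G : {set {set I}}) (S : {set I}).

Definition fshatters F S :=
  [forall B : {set I}, (B \subset S) ==> [exists A in F, A :&: S == B]].

Lemma fshattersP F S :
  reflect (forall B : {set I}, B \subset S -> exists2 A : {set I},
    A \in F & A :&: S = B)
    (fshatters F S).
Proof.
apply: (iffP forallP) => [h B BS|h B].
  by have /exists_inP[A AF /eqP] := implyP (h B) BS; exists A.
by apply/implyP => /h[A AF AB]; apply/exists_inP; exists A => //; apply/eqP.
Qed.

Lemma fshattersS F G S : F \subset G -> fshatters F S -> fshatters G S.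
Proof.
move=> FG /fshattersP h; apply/fshattersP => B /h[A AF AB].
by exists A => //; apply: (subsetP FG).
Qed.

(* If [x] splits [F] into nonempty [F0] (avoiding [x]) and [F1] (containing
   [x]), a set shattered by both stays shattered by [F] after adding [x]. *)
Lemma pajor F : #|F| <= #|[set S | fshatters F S]|.
Proof.
have [n] := ubnP #|F|; elim: n F => // n IH F; rewrite ltnS => Fn.
have [F2|] := ltnP 1 #|F|; last first.
  rewrite leq_eqVlt ltnS leqn0 cards_eq0 => /orP[/cards1P[A ->]|/eqP->]; last first.
    by rewrite cards0.
  rewrite cards1 card_gt0; apply/set0Pn; exists set0; rewrite inE.
  apply/fshattersP => B; rewrite subset0 => /eqP ->.
  by exists A; rewrite ?inE ?setI0.
have /card_gt1P[A1 [A2 [A1F A2F A12]]] := F2.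
have [x xA] : exists x, (x \in A1) != (x \in A2).
  apply/existsP; move: A12; apply: contraNT; rewrite negb_exists.
  by move=> /forallP h; apply/eqP/setP => x; have := h x; rewrite negbK => /eqP.
pose F1 := [set A in F | x \in A]; pose F0 := [set A in F | x \notin A].
have F01 : #|F| = #|F0| + #|F1|.
  rewrite -(cardsID [set A : {set I} | x \in A] F) addnC.
  by congr (_ + _); apply: eq_card => A; rewrite !inE // andbC.
have F1g : 0 < #|F1|.
  rewrite card_gt0; apply/set0Pn; move: xA; case: (boolP (x \in A1)) => xA1.
    by exists A1; rewrite inE A1F.
  by case: (boolP (x \in A2)) => // xA2; exists A2; rewrite inE A2F.
have F0g : 0 < #|F0|.
  rewrite card_gt0; apply/set0Pn; move: xA; case: (boolP (x \in A1)) => xA1; last first.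
    by exists A1; rewrite inE A1F.
  by case: (boolP (x \in A2)) => // xA2; exists A2; rewrite inE A2F.
have I0 : #|F0| <= #|[set S | fshatters F0 S]|.
  by apply: IH; rewrite (leq_trans _ Fn) // F01 -addn1 leq_add2l.
have I1 : #|F1| <= #|[set S | fshatters F1 S]|.
  by apply: IH; rewrite (leq_trans _ Fn) // F01 -add1n leq_add2r.
rewrite F01; apply: (leq_trans (leq_add I0 I1)).
set S0 := [set S | fshatters F0 S]; set S1 := [set S | fshatters F1 S].
have xS0 S : S \in S0 -> x \notin S.
  rewrite inE => /fshattersP/(_ S (subxx _))[A]; rewrite inE => /andP[_ xA'] AS.
  by apply: contra xA' => xS; move: xS; rewrite -AS inE => /andP[].
have xS1 S : S \in S1 -> x \notin S.
  rewrite inE => /fshattersP/(_ set0 (sub0set _))[A]; rewrite inE => /andP[_ xA'] AS.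
  by apply/negP => xS; have := in_set0 x; rewrite -AS inE xA' xS.
pose U := [set x |: S | S in S0 :&: S1].
have cU : #|U| = #|S0 :&: S1|.
  apply: card_in_imset => S S'; rewrite !inE => /andP[_ hS] /andP[_ hS'] e.
  have xS : x \notin S by apply: xS1; rewrite inE.
  have xS' : x \notin S' by apply: xS1; rewrite inE.
  by rewrite -(setU1K xS) e setU1K.
(* Inclusion-exclusion turns the sum into [#|S0 :|: S1| + #|U|]; the two families are disjoint,
   since only members of [U] contain [x]. *)
rewrite -cardsUI -cU -cardsUI.
have -> : (S0 :|: S1) :&: U = set0.
  apply/setP => S; rewrite !in_set0; apply/negbTE/negP => /setIP[S01 /imsetP[S' _ SE]].
  have : x \in S by rewrite SE setU11.
  by move: S01 => /setUP[/xS0/negbTE->|/xS1/negbTE->].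
rewrite cards0 addn0; apply: subset_leq_card; apply/subsetP => S.
rewrite [in X in _ -> X]inE.
move=> /setUP[/setUP[]|].
- by rewrite inE; apply: fshattersS; apply/subsetP => A; rewrite inE => /andP[].
- by rewrite inE; apply: fshattersS; apply/subsetP => A; rewrite inE => /andP[].
move=> /imsetP[S' /setIP[S'0 S'1] ->]; have xS' := xS0 _ S'0.
move: S'0 S'1; rewrite !inE => /fshattersP h0 /fshattersP h1.
apply/fshattersP => B BS.
have BxS : B :\ x \subset S' by rewrite subDset.
have [xB|xB] := boolP (x \in B).
  have [A] := h1 _ BxS; rewrite inE => /andP[AF xA'] AE; exists A => //.
  apply/setP => y; have := congr1 (fun Z : {set I} => y \in Z) AE; rewrite !inE.
  by case: eqVneq => [->|//]; rewrite xA' xB.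
have [A] := h0 _ BxS; rewrite inE => /andP[AF xA'] AE; exists A => //.
apply/setP => y; have := congr1 (fun Z : {set I} => y \in Z) AE; rewrite !inE.
by case: eqVneq => [->|//]; rewrite (negbTE xA') (negbTE xB).
Qed.

(** A set of at most [k] elements is the range of a map from ['I_k] to [option I], with [None] as
    padding. *)
Lemma card_bounded_sets k : #|[set S : {set I} | #|S| <= k]| <= #|I|.+1 ^ k.
Proof.
pose f (g : {ffun 'I_k -> option I}) := [set y : I | Some y \in codom g].
have -> : #|I|.+1 ^ k = #|{: {ffun 'I_k -> option I}}|.
  by rewrite card_ffun card_option card_ord.
apply: (leq_trans _ (leq_imset_card f _)).
apply: subset_leq_card; apply/subsetP => S; rewrite inE => Sk.
apply/imsetP; exists [ffun j : 'I_k => nth None [seq Some y | y <- enum S] j] => //.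
apply/setP => y; rewrite inE; apply/idP/idP => [yS|/codomP[j]].
  have yk : index y (enum S) < #|S| by rewrite cardE index_mem mem_enum.
  apply/codomP; exists (Ordinal (leq_trans yk Sk)); rewrite ffunE /=.
  by rewrite (nth_map y) ?nth_index ?mem_enum // -cardE.
rewrite ffunE; have [jS|jS] := ltnP j #|S|; last first.
  by rewrite nth_default // size_map -cardE.
rewrite (nth_map y) -?cardE // => -[->].
by rewrite -mem_enum mem_nth // -cardE.
Qed.

Lemma sauer_shelah F k :
  (forall S, fshatters F S -> #|S| <= k) -> #|F| <= #|I|.+1 ^ k.
Proof.
move=> h; apply: (leq_trans (pajor F)); apply: leq_trans (card_bounded_sets k).
by apply: subset_leq_card; apply/subsetP => S; rewrite !inE => /h.
Qed.

End Pajor.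

(** * Epsilon nets *)

Section EpsilonNet.
Variables (J : finType) (r : nat).
Let m := r.*2.
Implicit Types (A : {set J}) (N : {ffun 'I_m -> J}).

(** Expanding a product of sums counts the tuples coordinatewise; the factor [#|J|] on the left
    avoids the exponent [m - 1]. *)
Lemma card_ffun_preim (i : 'I_m) A :
  #|[set N : {ffun 'I_m -> J} | N i \in A]| * #|J| = #|A| * #|J| ^ m.
Proof.
pose G (k : 'I_m) (j : J) := if k == i then (j \in A : nat) else 1.
have -> : #|[set N : {ffun 'I_m -> J} | N i \in A]|
    = \sum_(N : {ffun 'I_m -> J}) \prod_k G k (N k).
  rewrite -sum1dep_card big_mkcond /=; apply: eq_bigr => N _.
  rewrite (bigD1 i) //= big1 => [|k /negbTE ki]; last by rewrite /G ki.
  by rewrite /G eqxx muln1; case: (N i \in A).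
rewrite -bigA_distr_bigA (bigD1 i) //= /G eqxx -mulnA; congr (_ * _).
  by rewrite -sum1_card [RHS]big_mkcond; apply: eq_bigr => j _; case: (j \in A).
rewrite (eq_bigr (fun=> #|J|)) => [|k /negbTE ->]; last by rewrite sum1_card.
have m0 : 0 < m by apply: leq_ltn_trans (ltn_ord i).
rewrite prod_nat_const -expnSr; congr (_ ^ _).
by rewrite (cardC1 i) card_ord prednK.
Qed.

(** Markov's inequality: a tuple misses [A] at most [m / 4 = r / 2] times on average, so at most
    half of the tuples miss it more than [r] times. *)
Lemma half_hit A : 0 < r -> 0 < #|J| -> 3 * #|J| <= 4 * #|A| ->
  #|J| ^ m <= 2 * #|[set N : {ffun 'I_m -> J} | r <= #|[set i | N i \in A]|]|.
Proof.
move=> r0 J0 hA; set h := [set N | _].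
have cA : 4 * #|~: A| <= #|J|.
  rewrite -(leq_add2l (4 * #|A|)) -mulnDr cardsC mulSn.
  by rewrite [X in X <= _]addnC leq_add2r.
pose s := \sum_(N : {ffun 'I_m -> J}) #|[set i | N i \in ~: A]|.
have sE : s * #|J| = m * (#|~: A| * #|J| ^ m).
  have -> : s = \sum_(i < m) #|[set N : {ffun 'I_m -> J} | N i \in ~: A]|.
    rewrite /s (eq_bigr (fun N : {ffun 'I_m -> J} => \sum_(i < m) (N i \in ~: A))).
      rewrite exchange_big /=; apply: eq_bigr => i _.
      rewrite -sum1dep_card [RHS]big_mkcond.
      by apply: eq_bigr => N _; case: (_ \in _).
    move=> N _; rewrite -sum1dep_card big_mkcond; apply: eq_bigr => i _.
    by case: (_ \in _).
  rewrite big_distrl (eq_bigr (fun=> #|~: A| * #|J| ^ m)) /=.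
    by rewrite sum_nat_const card_ord.
  by move=> i _; rewrite card_ffun_preim.
have s1 : r * #|~: h| <= s.
  rewrite /s (bigID (mem h)) /= addnC -[X in X <= _]addn0 leq_add //.
  rewrite mulnC -sum_nat_const.
  rewrite [X in X <= _](_ : _ = \sum_(N | N \notin h) r); last first.
    by apply: eq_bigl => N; rewrite inE.
  apply: leq_sum => N; rewrite inE -ltnNge => hN.
  have : #|[set i | N i \in A]| + #|[set i | N i \in ~: A]| = m.
    rewrite -[RHS](card_ord m) -(cardsC [set i | N i \in A]); congr (_ + _).
    by apply: eq_card => i; rewrite !inE.
  move=> e; rewrite leqNgt; apply/negP => /ltnW lr.
  by have := leq_add hN lr; rewrite addSn e addnn ltnn.
have s2 : 2 * s <= r * #|J| ^ m.
  rewrite -(leq_pmul2r J0) -mulnA sE.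
  have -> : 2 * (m * (#|~: A| * #|J| ^ m)) = r * #|J| ^ m * (4 * #|~: A|).
    rewrite {1}/m -muln2 [RHS]mulnAC !mulnA; congr (_ * _ * _).
    by rewrite [2 * r]mulnC -mulnA.
  by rewrite leq_mul2l cA orbT.
have cJ : #|h| + #|~: h| = #|J| ^ m.
  by rewrite cardsC card_ffun card_ord.
rewrite -(leq_add2r (2 * #|~: h|)) -mulnDr cJ [2 * #|J| ^ m]mulSn mul1n leq_add2l.
by rewrite -(leq_pmul2l r0) mulnCA (leq_trans _ s2) // leq_mul2l s1 orbT.
Qed.

Variables (F : {set {set J}}) (g : nat -> nat).
Hypothesis trF : forall (I : finType) (t : I -> J),
  #|[set [set i | t i \in A] | A : {set J} in F]| <= g #|I|.

Let hit (N N' : {ffun 'I_m -> J}) :=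
  [exists A : {set J} in F, [forall i, N i \notin A] &&
  (r <= #|[set i | N' i \in A]|)].
(** Reads the pair as one family of [4 * r] entries, so that exchanges act on indices only and the
    trace of a set on the entries does not depend on [s]. *)
Let sel (p : {ffun 'I_m -> J} * {ffun 'I_m -> J}) (x : bool * 'I_m) :=
  if x.1 then p.2 x.2 else p.1 x.2.
Let swap (s : {set 'I_m}) p : {ffun 'I_m -> J} * {ffun 'I_m -> J} :=
  ([ffun i => sel p (i \in s, i)], [ffun i => sel p (i \notin s, i)]).

Lemma swapK s : involutive (swap s).
Proof.
move=> [N N']; congr pair; apply/ffunP => i; rewrite !ffunE /sel /= !ffunE /=;
  by case: (i \in s).
Qed.

(* Once the trace [B] is known, [s] is determined outside the at most [r]
   coordinates that [B] misses altogether. *)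
Lemma card_avoiding_swaps (B : {set bool * 'I_m}) :
  #|[set s : {set 'I_m} | [forall i, (i \in s, i) \notin B] &&
      (r <= #|[set i | (i \notin s, i) \in B]|)]| <= 2 ^ r.
Proof.
set P := [set s | _].
have [->|/set0Pn[s0 s0P]] := eqVneq P set0; first by rewrite cards0.
pose K := [set i | ((true, i) \in B) || ((false, i) \in B)].
have Kr : #|~: K| <= r.
  have cK : #|K| + #|~: K| = r + r by rewrite cardsC card_ord addnn.
  rewrite -(leq_add2l r) -cK leq_add2r.
  move: s0P; rewrite inE => /andP[_ h]; apply: (leq_trans h).
  apply: subset_leq_card; apply/subsetP => i; rewrite !inE.
  by case: (i \in s0) => /= ->; rewrite ?orbT.
apply: (@leq_trans (2 ^ #|~: K|)); last by rewrite leq_exp2l.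
rewrite -card_powerset -(card_in_imset (f := fun s => s :&: ~: K) (D := P)).
  by apply: subset_leq_card; apply/subsetP => _ /imsetP[s _ ->]; rewrite inE subsetIr.
move=> s s'; rewrite !inE => /andP[/forallP hs _] /andP[/forallP hs' _] e.
apply/setP => i; have := congr1 (fun Z : {set 'I_m} => i \in Z) e; rewrite !inE.
move: (hs i) (hs' i); case: (i \in s); case: (i \in s') => //= h1 h2;
  by rewrite (negbTE h1) (negbTE h2).
Qed.

(** Union bound over the at most [g (4 * r)] traces of [F] on the entries of [p], each of which
    accounts for at most [2 ^ r] exchanges. *)
Lemma card_hitting_swaps p :
  #|[set s | hit (swap s p).1 (swap s p).2]| <= g (4 * r) * 2 ^ r.
Proof.
pose ok (B : {set bool * 'I_m}) (s : {set 'I_m}) :=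
  [forall i, (i \in s, i) \notin B] && (r <= #|[set i | (i \notin s, i) \in B]|).
pose tr : {set {set bool * 'I_m}} :=
  [set [set x | sel p x \in A] | A : {set J} in F].
apply: (@leq_trans (\sum_(B in tr) 2 ^ r)); last first.
  rewrite sum_nat_const leq_mul2r; apply/orP; right.
  apply: (leq_trans (trF (sel p))).
  by rewrite card_prod card_bool card_ord /m -mul2n mulnA.
apply: (@leq_trans (\sum_(B in tr) #|[set s | ok B s]|)); last first.
  by apply: leq_sum => B _; exact: card_avoiding_swaps.
rewrite (eq_bigr (fun B => \sum_(s : {set 'I_m}) ok B s)); last first.
  move=> B _; rewrite -sum1dep_card big_mkcond; apply: eq_bigr => s _.
  by case: (ok B s).
rewrite exchange_big -sum1dep_card big_mkcond /=; apply: leq_sum => s _.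
case: ifP => // /exists_inP[A AF /andP[/forallP h1 h2]].
rewrite (bigD1 [set x | sel p x \in A]) /=; last exact: imset_f.
suff -> : ok [set x | sel p x \in A] s by [].
apply/andP; split; first by apply/forallP => i; have := h1 i; rewrite inE ffunE.
apply: (leq_trans h2); apply: subset_leq_card; apply/subsetP => i.
by rewrite !inE ffunE.
Qed.

(* Double sampling: if every [m]-tuple [N] were avoided by some member of [F],
   an independent second tuple [N'] would hit that member often; exchanging
   coordinates of [N] and [N'] at random makes this exponentially unlikely for
   each of the few traces of [F] on [N] and [N']. *)
Lemma epsilon_net : 0 < r -> 0 < #|J| ->
  (forall A, A \in F -> 3 * #|J| <= 4 * #|A|) ->
  2 * g (4 * r) < 2 ^ r ->
  exists N : {ffun 'I_m -> J}, forall A : {set J}, A \in F -> exists i, N i \in A.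
Proof.
move=> r0 J0 dF gr.
case: (boolP [exists N : {ffun 'I_m -> J},
    [forall A : {set J} in F, [exists i, N i \in A]]]).
  move=> /existsP[N /forall_inP h]; exists N => A /h /existsP[i]; by exists i.
rewrite negb_exists => /forallP nN; exfalso.
pose M := #|J| ^ m.
have cM : #|{: {ffun 'I_m -> J}}| = M by rewrite card_ffun card_ord.
have M0 : 0 < M by rewrite expn_gt0 J0.
pose W := \sum_(p : {ffun 'I_m -> J} * {ffun 'I_m -> J}) (hit p.1 p.2 : nat).
(* Each [N] is avoided by some member of [F], which at least half of the tuples [N'] hit [r] times
   or more. *)
have W1 : M * M <= 2 * W.
  rewrite /W -(pair_bigA _ (fun N N' => (hit N N' : nat))) /= big_distrr /=.
  rewrite -{1}cM -sum_nat_const; apply: leq_sum => N _.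
  have := nN N; rewrite negb_forall_in => /exists_inP[A AF hA].
  apply: (leq_trans (half_hit r0 J0 (dF A AF))); rewrite leq_mul2l /=.
  rewrite -sum1dep_card big_mkcond; apply: leq_sum => N' _.
  case: ifP => // h; suff -> : hit N N' by [].
  by apply/exists_inP; exists A => //; rewrite h andbT -negb_exists.
(* Each exchange permutes the pairs, so summing over all [2 ^ m] exchanges counts [W] that often;
   for a fixed pair, few exchanges produce a hit. *)
have W2 : 2 ^ m * W <= M * M * (g (4 * r) * 2 ^ r).
  have -> : 2 ^ m * W = \sum_(s : {set 'I_m}) \sum_p hit (swap s p).1 (swap s p).2.
    rewrite (eq_bigr (fun=> W)).
      by rewrite sum_nat_const -cardsT -powersetT card_powerset cardsT card_ord.
    by move=> s _; rewrite /W [RHS](reindex_inj (inv_inj (swapK s))).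
  rewrite exchange_big /=.
  have -> : M * M = #|{: {ffun 'I_m -> J} * {ffun 'I_m -> J}}|.
    by rewrite card_prod cM.
  rewrite -sum_nat_const; apply: leq_sum => p _.
  apply: leq_trans (card_hitting_swaps p).
  rewrite -sum1dep_card [X in _ <= X]big_mkcond.
  by apply: leq_sum => s _; case: (hit _ _).
have : 2 ^ m * (M * M) <= M * M * (2 ^ r * (2 * g (4 * r))).
  apply: (@leq_trans (2 ^ m * (2 * W))); first by rewrite leq_mul2l W1 orbT.
  rewrite mulnCA (leq_trans (leq_mul (leqnn 2) W2)) // leq_eqVlt; apply/orP; left.
  by rewrite mulnCA [_ * 2 ^ r]mulnC [2 * (2 ^ r * _)]mulnCA.
rewrite mulnC leq_pmul2l ?muln_gt0 ?M0 // /m -addnn expnD leq_pmul2l ?expn_gt0 //.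
by rewrite leqNgt gr.
Qed.

End EpsilonNet.

(** * Boosting *)

(* Errors multiply the weight by [2 ^ b], so each round at most doubles the
   total weight. *)
Lemma multiplicative_weights (Y : Type) (D : Y -> Prop) (n b : nat)
    (err : Y -> 'I_n -> bool) : 0 < n ->
  (forall w : 'I_n -> nat, 0 < \sum_i w i ->
     exists2 y, D y & 2 ^ b * \sum_(i | err y i) w i <= \sum_i w i) ->
  forall M, exists2 t : nat -> Y, (forall j, D (t j)) &
    \sum_i 2 ^ (b * \sum_(j < M) err (t j) i) <= n * 2 ^ M.
Proof.
move=> n0 hw; have w0 (e : 'I_n -> nat) : 0 < \sum_i 2 ^ e i.
  by rewrite (bigD1 (Ordinal n0)) //= ltn_addr // expn_gt0.
elim=> [|M [t Dt ht]].
  have [y Dy _] := hw _ (w0 (fun=> 0)); exists (fun=> y) => //.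
  under eq_bigr do rewrite big_ord0 muln0.
  by rewrite sum_nat_const card_ord.
have [y Dy hy] := hw _ (w0 (fun i => b * \sum_(j < M) err (t j) i)).
exists (fun j => if j < M then t j else y) => [j|]; first by case: ifP.
set w := fun i => 2 ^ (b * \sum_(j < M) err (t j) i) in hy ht.
have wE i : 2 ^ (b * \sum_(j < M.+1) err (if j < M then t j else y) i)
    = (if err y i then 2 ^ b else 1) * w i.
  rewrite big_ord_recr /= ltnn mulnDr expnD mulnC; congr (_ * _).
    by case: (err y i); rewrite ?muln1 ?muln0.
  by rewrite /w; congr (2 ^ (b * _)); apply: eq_bigr => j _; rewrite ltn_ord.
under eq_bigr do rewrite wE.
rewrite expnS mulnCA mul2n -addnn; apply: leq_trans (leq_add ht ht).
rewrite (bigID (fun i => err y i)) /=; apply: leq_add.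
  rewrite (eq_bigr (fun i => 2 ^ b * w i)) => [|i ->//].
  by rewrite -big_distrr.
rewrite (eq_bigr w) => [|i /negbTE ->]; last by rewrite mul1n.
by rewrite [X in _ <= X](bigID (fun i => err y i)) /= leq_addl.
Qed.

From mathcomp Require Import all_order all_algebra zify.
From mathcomp Require Import all_classical all_reals all_analysis.
Import Order.TTheory GRing.Theory Num.Theory.
Import numFieldNormedType.Exports.
Import Defs.

Local Open Scope classical_set_scope.

(** * Growth of classes and of their duals *)

Section Growth.
Variable X : Type.
Implicit Types K : set (set X).

Definition traces K (I : finType) (x : I -> X) : {set {set I}} :=
  [set B : {set I} | `[< exists2 A, K A & forall i, (i \in B) = (x i \in A) >]]%SET.

(** Traces of the dual class, in which the points of [X] act as sets of indices. *)
Definition cotraces (I : finType) (A : I -> set X) : {set {set I}} :=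
  [set B : {set I} | `[< exists y, forall i, (i \in B) = (y \in A i) >]]%SET.

(** The base is at least 2 even for empty [I], so constant factors can be absorbed into the
    exponent. *)
Definition poly_growth K := exists a, forall (I : finType) (x : I -> X),
  #|traces K x| <= #|I|.+2 ^ a.

(** Shattering for indexed points, which suits finite types; the singletons [b] force the points to
    be distinct. *)
Definition shatters_points K (w : nat) (y : 'I_w -> X) :=
  forall b : {set 'I_w}, exists2 A, K A & forall j, (y j \in A) = (j \in b).

Lemma finite_VC_dim_points K : finite_VC_dim K ->
  exists k, forall w (y : 'I_w -> X), shatters_points K y -> w <= k.
Proof.
move=> [k hk]; exists k => -[//|w] y hy.
pose f (n : nat) := y (inord n).
have yinj i j : y i = y j -> i = j.
  move=> e; have [A _ hA] := hy [set i]%SET.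
  by have := hA j; rewrite -e hA !finset.in_set1 eqxx => /esym/eqP.
apply: (hk (f @` `I_w.+1) w.+1).
  apply: inj_card_eq => n n'; rewrite !inE /= => nw n'w /yinj e.
  by rewrite -(inordK nw) e inordK.
move=> B BS; have [A KA hA] := hy [set j | y j \in B]%SET; exists A => //.
apply/seteqP; split => z.
  move=> [Az [n nw fz]]; rewrite -fz in Az *.
  by have := hA (inord n); rewrite finset.in_set -/(f n) (mem_set Az) => /esym/set_mem.
move=> Bz; split; last exact: BS.
have [n nw fz] := BS _ Bz; rewrite -fz in Bz *.
by have := hA (inord n); rewrite finset.in_set -/(f n) (mem_set Bz) => /set_mem.
Qed.

Lemma points_finite_VC_dim K k :
  (forall w (y : 'I_w -> X), shatters_points K y -> w <= k) ->
  finite_VC_dim K.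
Proof.
move=> hk; exists k => S n /card_set_bijP[f [fS finj fsurj]] hS.
have [i|y hy] := @fin_all_exists 'I_n (fun=> X) (fun i y => S y /\ f y = i).
  by have [x Sx fx] := fsurj i (ltn_ord i); exists x.
have yinj i j : y i = y j -> i = j.
  by move=> e; apply/val_inj => /=; rewrite -(hy i).2 -(hy j).2 e.
apply: (hk n y) => b.
have [|A KA AB] := hS (y @` [set j | j \in b]).
  by move=> _ [j _ <-]; exact: (hy j).1.
exists A => // j; apply/idP/idP => [|jb].
  rewrite inE => Ayj; have : (A `&` S) (y j) by split => //; exact: (hy j).1.
  by rewrite AB => -[j' j'b /yinj <-].
rewrite inE; have : (y @` [set j | j \in b]) (y j) by exists j.
by rewrite -AB => -[].
Qed.

Lemma poly_growth_finite_VC_dim K : finite_VC_dim K -> poly_growth K.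
Proof.
move=> /finite_VC_dim_points[k hk]; exists k => I x.
apply: (@leq_trans (#|I|.+1 ^ k)); last by case: k {hk} => // k; rewrite leq_exp2r.
apply: sauer_shelah => S /fshattersP hS.
apply: (hk _ (fun j : 'I_#|S| => x (enum_val j))) => b.
have [|B] := hS [set enum_val j | j in b]%SET.
  by apply/fintype.subsetP => _ /imsetP[j _ ->]; exact: enum_valP.
rewrite finset.in_set => /asboolP[A KA hA] BS; exists A => // j.
rewrite -hA; have := congr1 (fun Z : {set I} => enum_val j \in Z) BS.
rewrite finset.in_setI enum_valP andbT => ->.
by rewrite mem_imset //; exact: enum_val_inj.
Qed.

(** Shattering [w] points takes [2 ^ w] traces, more than a polynomial in [w] allows once [w] is
    large. *)
Lemma poly_growth_points K : poly_growth K ->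
  exists k, forall w (y : 'I_w -> X), shatters_points K y -> w <= k.
Proof.
move=> [a ha]; have [k hk] := exp2_dominates a 2; exists k => w y hy.
rewrite leqNgt; apply/negP => /ltnW /hk; rewrite ltnNge => /negP; apply.
have -> : 2 ^ w = #|traces K y|.
  rewrite -[w in LHS]card_ord -cardsT -card_powerset powersetT; apply: eq_card => b.
  rewrite finset.in_setT finset.in_set; apply/esym/asboolP; have [A KA hA] := hy b.
  by exists A => // i; rewrite hA.
apply: (leq_trans (ha _ y)); rewrite card_ord.
by case: a {ha hk} => // a; rewrite leq_exp2r // mul2n doubleS !ltnS -addnn leq_addl.
Qed.

(* A set of [2 ^ w] members of [K] shattered by the points, indexed by the
   subsets of ['I_w], yields [w] points shattered by [K]. *)
Lemma cotraces_growth K : poly_growth K ->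
  exists a, forall (I : finType) (A : I -> set X), (forall i, K (A i)) ->
    #|cotraces A| <= #|I|.+1 ^ a.
Proof.
move=> /poly_growth_points[k hk]; exists (2 ^ k.+1) => I A KA.
apply: sauer_shelah => S /fshattersP hS; rewrite leqNgt; apply/negP => Sk.
have cb : #|{: {set 'I_k.+1}}| <= #|S|.
  apply: leq_trans (ltnW Sk); rewrite -cardsT -powersetT card_powerset cardsT.
  by rewrite card_ord.
pose phi (b : {set 'I_k.+1}) : I := enum_val (widen_ord cb (enum_rank b)).
have phiS b : phi b \in S by exact: enum_valP.
have phi_inj : injective phi.
  by move=> b b' /enum_val_inj /(congr1 val) /= e; apply/enum_rank_inj/val_inj.
(* The point for [j] realises, among the shattered sets, the subfamily indexed by the [b] containing
   [j]; conversely [A (phi b)] then cuts out [b] among the points. *)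
have [j|y hy] := @fin_all_exists 'I_k.+1 (fun=> X)
    (fun j y => forall b, (y \in A (phi b)) = (j \in b)).
  have [|C] := hS [set phi b | b : {set 'I_k.+1} & j \in b]%SET.
    by apply/fintype.subsetP => _ /imsetP[b _ ->].
  rewrite finset.in_set => /asboolP[y hC] CS; exists y => b.
  rewrite -hC; have := congr1 (fun Z : {set I} => phi b \in Z) CS.
  by rewrite finset.in_setI phiS andbT => ->; rewrite mem_imset // finset.in_set.
have := hk _ y; rewrite ltnn => h; suff: false by []; apply: h => b.
by exists (A (phi b)).
Qed.

(** The trace of a tree is determined by those of its root test and its two subtrees, whose
    exponents add up; an extra 2 in the exponent pays for the constant traces of leaves. *)
Lemma poly_growth_Alg K k : poly_growth K -> poly_growth (Alg K k).
Proof.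
move=> [h hh].
have leaf (I : finType) (x : I -> X) b (B : {set I}) :
    (forall i, (i \in B) = (x i \in concept_of (@Leaf X b))) ->
    B \in [set finset.set0; [set: I]]%SET.
  move=> hB; rewrite !finset.inE; apply/orP.
  case: b hB => hB; [right|left]; apply/eqP/setP => i; rewrite hB finset.inE.
    by rewrite mem_set.
  by rewrite memNset.
elim: k => [|k [a ha]].
  exists 1 => I x; rewrite expn1.
  apply: (@leq_trans #|[set finset.set0; [set: I]]%SET|).
    apply/subset_leq_card/fintype.subsetP => B.
    rewrite finset.in_set => /asboolP[_ [T [_ dT] <-]].
    by case: T dT => // b _ /leaf.
  by rewrite cards2; case: (_ != _).
exists (2 + (h + (a + a))) => I x.
pose f (p : {set I} * ({set I} * {set I})) :=
  ((p.1 :&: p.2.2) :|: (p.2.1 :\: p.1))%SET.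
pose Z := finset.setX (traces K x)
  (finset.setX (traces (Alg K k) x) (traces (Alg K k) x)).
apply: (@leq_trans #|([set finset.set0; [set: I]] :|: f @: Z)%SET|).
  apply/subset_leq_card/fintype.subsetP => B.
  rewrite /traces [X in is_true X -> _]finset.in_set.
  move=> /asboolP[_ [T [bT dT] <-] hB]; rewrite finset.in_setU; apply/orP.
  case: T bT dT hB => [b _ _ /leaf|g T0 T1 /= [Kg b0 b1] dT hB]; [by left|right].
  move: dT; rewrite ltnS geq_max => /andP[d0 d1].
  apply/imsetP; exists ([set i | x i \in g],
     ([set i | eval T0 (x i)], [set i | eval T1 (x i)]))%SET.
    rewrite !finset.in_setX /= !finset.in_set; apply/and3P; split; apply/asboolP.
    - by exists g => // i; rewrite finset.in_set.
    - exists (concept_of T0); first by exists T0.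
      by move=> i; rewrite finset.in_set; apply/idP/idP => [?|/set_mem//]; exact: mem_set.
    - exists (concept_of T1); first by exists T1.
      by move=> i; rewrite finset.in_set; apply/idP/idP => [?|/set_mem//]; exact: mem_set.
  apply/setP => i; rewrite hB /f !finset.inE /=.
  have -> : (x i \in concept_of (Node g T0 T1)) = eval (Node g T0 T1) (x i).
    by apply/idP/idP => [/set_mem//|?]; exact: mem_set.
  by rewrite /=; case: (x i \in g); rewrite /= ?orbF.
apply: (leq_trans (leq_card_setU _ _)).
set n := #|I|; set q := n.+2 ^ (h + (a + a)).
have q0 : 0 < q by rewrite expn_gt0.
have cZ : #|(f @: Z)%SET| <= q.
  apply: (leq_trans (leq_imset_card _ _)); rewrite /q !cardsX !expnD.
  by apply: leq_mul; [exact: hh|apply: leq_mul; exact: ha].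
rewrite expnD -/q; apply: (@leq_trans (2 + q)).
  by apply: leq_add => //; rewrite cards2; case: (_ != _).
apply: (@leq_trans (2 ^ 2 * q)); last by rewrite leq_mul2r leq_exp2r ?orbT.
rewrite -[2 ^ 2]/4.
by rewrite mulSn [2 + q]addnC leq_add2l (@leq_trans 3) // leq_pmulr.
Qed.

End Growth.

(** * Decision trees *)

Section TreeOperations.
Variable X : Type.
Implicit Types T : dtree X.

(** Lets a whole tree serve as a test, although nodes hold only members of the class. *)
Fixpoint graft T T0 T1 : dtree X :=
  match T with
  | Leaf b => if b then T1 else T0
  | Node f L R => Node f (graft L T0 T1) (graft R T0 T1)
  end.

Lemma eval_graft T T0 T1 x :
  eval (graft T T0 T1) x = if eval T x then eval T1 x else eval T0 x.
Proof.
by elim: T => [[]|f L IHL R IHR] //=; case: (x \in f).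
Qed.

Lemma based_graft H T T0 T1 :
  based H T -> based H T0 -> based H T1 -> based H (graft T T0 T1).
Proof.
move=> + b0 b1; elim: T => [[]|f L IHL R IHR] //= [Hf bL bR].
by split; [|exact: IHL|exact: IHR].
Qed.

Lemma depth_graft T T0 T1 e : depth T0 <= e -> depth T1 <= e ->
  depth (graft T T0 T1) <= depth T + e.
Proof.
move=> d0 d1; elim: T => [[]|f L IHL R IHR] //=.
rewrite addSn ltnS geq_max; apply/andP; split.
  by apply: (leq_trans IHL); rewrite leq_add2r leq_maxl.
by apply: (leq_trans IHR); rewrite leq_add2r leq_maxr.
Qed.

(** Realises an arbitrary Boolean function of the answers of several trees as a single tree. *)
Fixpoint combine (ts : seq (dtree X)) (g : seq bool -> bool) : dtree X :=
  if ts is T :: ts' then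
    graft T (combine ts' (fun v => g (false :: v)))
            (combine ts' (fun v => g (true :: v)))
  else Leaf (g [::]).

Lemma eval_combine ts g x : eval (combine ts g) x = g [seq eval T x | T <- ts].
Proof.
elim: ts g => //= T ts IH g; rewrite eval_graft !IH.
by case: (eval T x).
Qed.

Lemma Alg_combine H d (J : Type) (t : J -> dtree X) (s : seq J) g :
  (forall j, based H (t j) /\ depth (t j) <= d) ->
  based H (combine (map t s) g) /\ depth (combine (map t s) g) <= size s * d.
Proof.
move=> ht; elim: s g => //= j s IH g; split.
  by apply: based_graft; [exact: (ht j).1|exact: (IH _).1|exact: (IH _).1].
rewrite mulSn; apply: (leq_trans (depth_graft _ (IH _).2 (IH _).2)).
by rewrite leq_add2r; exact: (ht j).2.
Qed.

(** Error at most [2 ^ -b] under every finitely supported distribution, cleared of denominators so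
    that boosting stays within the natural numbers. *)
Definition weakly_learnable (H : set (set X)) (c : set X) (b d : nat) :=
  forall n (x : 'I_n -> X) (w : 'I_n -> nat), 0 < \sum_i w i ->
    exists2 T, based H T /\ depth T <= d &
      2 ^ b * \sum_(i | eval T (x i) != (x i \in c)) w i <= \sum_i w i.

Lemma consistent_tree H c d : poly_growth H -> weakly_learnable H c 9 d ->
  exists k, forall n (x : 'I_n -> X), exists T,
    [/\ based H T, depth T <= k & forall i, eval T (x i) = (x i \in c)].
Proof.
move=> /(poly_growth_Alg d)/cotraces_growth[a ha] wl.
(* The exponent [a * 2] comes from pairs of cotraces, the additional 1 absorbs the factor 2, and
   [4 * r + 1 <= 4 * r.+1]. *)
have [r0 hr0] := exp2_dominates (a * 2).+1 4.
pose r := r0.+1; pose g n := n.+1 ^ a * n.+1 ^ a.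
have gr : 2 * g (4 * r) < 2 ^ r.
  apply: leq_ltn_trans (hr0 r (leqnSn _)); rewrite expnS leq_mul //.
  rewrite /g -expnD addnn -muln2; case: (a * 2) => // e; rewrite leq_exp2r //.
  by rewrite mulnS -addn1 addnC leq_add2r.
exists (r.*2 * d) => -[|n] x; first by exists (Leaf true); split => // -[].
pose err T i := eval T (x i) != (x i \in c).
have [t Dt ht] := @multiplicative_weights _
  (fun T => based H T /\ depth T <= d) n.+1 9 err isT (wl _ x) (8 * n.+1).
(* A point with [e] errors has weight [2 ^ (9 * e)], at most [n.+1 * 2 ^ (8 * n.+1)] and so below
   [2 ^ (9 * n.+1)]. *)
have wrong i : \sum_(j < 8 * n.+1) err (t j) i <= n.+1.
  rewrite -(leq_pmul2l (isT : 0 < 9)) -(@leq_exp2l 2) //.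
  apply: (leq_trans _ (leq_trans ht _)).
    by rewrite (bigD1 i) //= leq_addr.
  by rewrite [9 * _]mulSn expnD leq_mul2r ltnW ?orbT // ltn_expl.
pose J := 'I_(8 * n.+1).
pose sep (p : 'I_n.+1 * 'I_n.+1) : {set J} :=
  [set j : J | eval (t j) (x p.1) != eval (t j) (x p.2)]%SET.
pose F := [set sep p | p : 'I_n.+1 * 'I_n.+1 & (x p.1 \in c) != (x p.2 \in c)]%SET.
(* A trace of [sep p] is the symmetric difference of the cotraces of the two sample points. *)
have trF (I : finType) (u : I -> J) :
    #|[set [set i | u i \in A] | A : {set J} in F]%SET| <= g #|I|.
  pose C := cotraces (fun i => concept_of (t (u i))).
  have cC : #|C| <= #|I|.+1 ^ a.
    by apply: ha => i; exists (t (u i)) => //; exact: Dt.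
  apply: leq_trans (leq_mul cC cC); rewrite -cardsX.
  pose f (p : {set I} * {set I}) := [set i | (i \in p.1) != (i \in p.2)]%SET.
  apply: leq_trans (leq_imset_card f _); apply/subset_leq_card/fintype.subsetP.
  move=> _ /imsetP[_ /imsetP[p _ ->] ->].
  have Ci q : [set i | eval (t (u i)) (x q)]%SET \in C.
    rewrite finset.in_set; apply/asboolP; exists (x q) => i.
    by rewrite finset.in_set; apply/idP/idP => [?|/set_mem//]; exact: mem_set.
  apply/imsetP; exists ([set i | eval (t (u i)) (x p.1)],
    [set i | eval (t (u i)) (x p.2)])%SET.
    by rewrite finset.in_setX /= !Ci.
  by apply/setP => i; rewrite /f /sep !finset.in_set /=.
have dF A : A \in F -> 3 * #|J| <= 4 * #|A|.
  move=> /imsetP[p]; rewrite finset.in_set => cp ->.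
  (* A tree that gives both points the same answer errs on one of them, because their labels
     differ. *)
  have : #|~: sep p|%SET <= n.+1 + n.+1.
    apply: leq_trans (leq_add (wrong p.1) (wrong p.2)); rewrite -big_split /=.
    rewrite -sum1_card big_mkcond; apply: leq_sum => j _.
    rewrite !finset.in_set negbK /err; case: eqP => // ->.
    by move: cp; case: (eval _ _); case: (_ \in c); case: (_ \in c).
  rewrite -(leq_add2l #|sep p|) cardsC card_ord => h.
  by move: h; lia.
have J0 : 0 < #|J| by rewrite card_ord.
have [N hN] := epsilon_net trF (isT : 0 < r) J0 dF gr.
pose ts := [seq t (N j) | j <- enum 'I_(r.*2)].
pose val_at y := [seq eval (t (N j)) y | j <- enum 'I_(r.*2)].
(* An answer vector is labelled positive if some positive sample point produces it; since the net
   separates opposite labels, no negative sample point shares it. *)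
pose lab v := `[< exists2 i, val_at (x i) = v & x i \in c >].
have tsE y : [seq eval T y | T <- ts] = val_at y by rewrite -map_comp.
have [bT dT] := @Alg_combine H d _ (fun j => t (N j)) (enum 'I_(r.*2)) lab
  (fun j => Dt (N j)).
exists (combine ts lab); split => //; first by rewrite size_enum_ord in dT.
move=> i; rewrite eval_combine tsE; apply/asboolP/idP => [[i' e ci']|ci]; last first.
  by exists i.
apply: contraT => nci; have /hN[j] : sep (i', i) \in F.
  by apply/imset_f; rewrite finset.in_set /= ci' (negbTE nci).
rewrite finset.in_set /= => /negP[]; apply/eqP.
have vE y : nth true (val_at y) j = eval (t (N j)) y.
  by rewrite /val_at (nth_map j) ?size_enum_ord // nth_ord_enum.
by rewrite -!vE e.
Qed.

End TreeOperations.

(** * Error under a probability measure *)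

Section Measure.
Context (R : realType) (d : measure_display) (X : measurableType d).
Local Open Scope ring_scope.

Lemma measurable_concept_of (H : set (set X)) (T : dtree X) :
  (forall h, H h -> measurable h) -> based H T -> measurable (concept_of T).
Proof.
move=> mH; elim: T => [b _|f T0 IH0 T1 IH1 /= [Hf b0 b1]].
  case: b;
    [rewrite (_ : concept_of _ = setT)|rewrite (_ : concept_of _ = set0)] => //;
    by apply/seteqP; split.
rewrite (_ : concept_of _ = (f `&` concept_of T1) `|` (concept_of T0 `\` f)).
  by apply: measurableU; [apply: measurableI|apply: measurableD];
    [exact: mH|exact: IH1|exact: IH0|exact: mH].
apply/seteqP; split => x; rewrite /concept_of /=.
  by case: ifPn => [/set_mem|/negP xf] ? ; [left|right; split=> // /mem_set].
by move=> [[/mem_set -> //]|[? xf]]; case: ifPn => // /set_mem.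
Qed.

Lemma errorE (T : dtree X) (c : set X) :
  [set x | eval T x != (x \in c)] = concept_of T `+` c.
Proof.
apply/seteqP; split => x; rewrite /concept_of /setY /=.
  case: (boolP (x \in c)) => [/set_mem xc|/negP xc]; case: (eval T x) => //= _.
    by right.
  by left; split=> // /mem_set.
move=> [[-> xc]|[/mem_set -> nT]]; first by rewrite memNset.
by case: (eval T x) nT.
Qed.

(** Interpretability is applied to the distribution that gives each sample point mass proportional
    to its weight. *)
Lemma interpretable_weakly_learnable (H : set (set X)) (c : set X)
    (f' : R -> nat) (b : nat) : interpretable_within H c f' ->
  weakly_learnable H c b (f' (2 ^- b)).
Proof.
move=> hf n x w w0.
have n0 : (0 < n)%N by case: n x w w0 => // x w; rewrite big_ord0.
pose i0 : 'I_n := Ordinal n0.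
pose y (k : nat) := x (insubd i0 k); pose v (k : nat) := w (insubd i0 k).
have ordE (k : 'I_n) : insubd i0 k = k.
  by apply/val_inj; rewrite /= val_insubd ltn_ord.
pose mu : {measure set X -> \bar R} :=
  msum (fun k => mscale (NngNum (ler0n R (v k)))
    (\d_(y k) : {measure set X -> \bar R})) n.
(* [mnormalize] takes a fallback for zero or infinite mass; here the total mass is [W], which is
   positive and finite. *)
pose P : probability X R := mnormalize mu (\d_(x i0) : probability X R).
have muE (A : set X) : mu A = ((\sum_(i | x i \in A) w i)%N%:R)%:E.
  rewrite /mu /= /msum natr_sum [X in _ = X%:E]big_mkcond /= -sumEFin.
  apply: eq_bigr => k _.
  rewrite /mscale /= /y /v ordE diracE.
  by case: (x k \in A) => /=; rewrite ?mule1 ?mule0.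
set W := (\sum_i w i)%N in w0 *.
have muT : mu setT = W%:R%:E.
  by rewrite muE; congr (_%:R%:E); apply: eq_bigl => i; rewrite in_setT.
have e0 : 0 < 2 ^- b :> R by rewrite invr_gt0 exprn_gt0.
have e1 : 2 ^- b <= 1 :> R by rewrite invf_le1 ?exprn_gt0 // exprn_ege1 // ler1n.
have [T [bT dT hT]] := hf P _ e0 e1; exists T => //.
have WR : 0 < W%:R :> R by rewrite ltr0n.
move: hT; rewrite /P /= /mnormalize muT /= eqe gt_eqF //= muE -EFinM lee_fin.
rewrite ler_pdivrMr // ler_pdivlMl ?exprn_gt0 // -natrX -natrM ler_nat.
apply: leq_trans; rewrite leq_mul2l; apply/orP; right.
by rewrite leq_eqVlt; apply/orP; left; apply/eqP/eq_bigl => i; rewrite mem_setE.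
Qed.

(** A tree consistent with [c] on a good sample has empirical error 0, so uniform convergence bounds
    its true error by [e]. *)
Lemma VC_interpretable (H : set (set X)) (c : set X) (k : nat) :
  (forall h, H h -> measurable h) -> measurable c ->
  VC_theorem_applies R H c -> poly_growth H ->
  (forall n (x : 'I_n -> X), exists T,
    [/\ based H T, (depth T <= k)%N & forall i, eval T (x i) = (x i \in c)]) ->
  @interpretable_within R d X H c (fun=> k).
Proof.
move=> mH mc VC gH hx P e e0 _.
(* Symmetric difference with [c] flips the required pattern at the points of [c], so both classes
   shatter the same points. *)
have fin : finite_VC_dim [set T `+` c | T in Alg H k].
  have [w hw] := poly_growth_points (poly_growth_Alg k gH).
  apply: (points_finite_VC_dim (k := w)) => n y hy; apply: (hw n y) => b.
  have [_ [A KA <-] hA] := hy [set j | (j \in b) (+) (y j \in c)]%SET.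
  exists A => // j; have := hA j; rewrite finset.in_set.
  have -> : (y j \in A `+` c) = (y j \in A) (+) (y j \in c).
    apply/idP/idP => [/set_mem[[yA yc]|[yA yc]]|].
    - by rewrite mem_set // memNset.
    - by rewrite memNset // mem_set.
    - case: (boolP (y j \in A)) => [/set_mem yA|/negP yA];
      case: (boolP (y j \in c)) => [/set_mem yc|/negP yc] //= _; apply/mem_set.
        by left; split=> // /mem_set.
      by right; split=> // /mem_set.
  by case: (_ \in A); case: (_ \in c); case: (_ \in b).
(* Bounding the bad event by [2^-1], which is below 1, guarantees a sample outside it. *)
have half0 : 0 < 2^-1 :> R by rewrite invr_gt0.
have subAlg : Alg H k `<=` \bigcup_k Alg H k by move=> A HA; exists k.
have [n0 hn] := VC P _ subAlg fin e 2^-1 e0 half0.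
have [E [mE PE hE]] := hn n0 (leqnn _).
have [s sE] : exists s, ~ E s.
  apply: contrapT => /forallNP nE; have ET : E = setT.
    by apply/seteqP; split => // s _; apply: contrapT; exact: nE.
  move: PE; rewrite ET probability_setT lee_fin invf_ge1 //.
  by rewrite leNgt ltr1n.
have [T [bT dT hT]] := hx n0 (tnth s); exists T; split => //.
rewrite errorE; have mT : measurable (concept_of T `+` c).
  by apply: measurableU; apply: measurableD => //; exact: measurable_concept_of bT.
have := hE s sE (concept_of T `+` c); rewrite /empirical.
have -> : count (fun x => x \in concept_of T `+` c) s = 0%N.
  apply/eqP; rewrite -leqn0 leqNgt -has_count; apply/hasPn => x /tnthP[i ->].
  rewrite memNset // -errorE /=; by rewrite hT eqxx.
rewrite mul0r sub0r normrN => h.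
have {h}/(_ _)/(le_trans (ler_norm _)) h := h _.
rewrite -[P _]fineK ?lee_fin ?h //; last exact: fin_num_measure.
by exists (concept_of T) => //; exists T.
Qed.

Lemma clos_interpretable (H : set (set X)) (c : set X) (k : nat) :
  clos R (Alg H k) c -> @interpretable_within R d X H c (fun=> k).
Proof.
move=> [mc hc] P e e0 _; have [h_ [Hh hl]] := hc P.
have /fine_cvgP[hfin /cvgr_lt/(_ e e0) hlt] := hl.
have [n [fn ln]] := filter_ex (filterI hfin hlt).
have [T [bT dT] TE] := Hh n; exists T; split => //.
by rewrite errorE TE setYC -(fineK fn) lee_fin ltW.
Qed.

(** Trees of error at most [1 / n.+1] form the approximating sequence; the constant depth keeps them
    in one [Alg H k]. *)
Lemma interpretable_clos (H : set (set X)) (c : set X) (k : nat) :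
  measurable c -> (forall h, H h -> measurable h) ->
  @interpretable_within R d X H c (fun=> k) -> clos R (Alg H k) c.
Proof.
move=> mc mH hc; split=> // P.
have [n|T hT] := @choice nat (dtree X) (fun n T => [/\ based H T,
    (depth T <= k)%N & (P (concept_of T `+` c) <= (n.+1%:R^-1)%:E)%E]).
  have [||T] := hc P n.+1%:R^-1;
    [by rewrite invr_gt0|by rewrite invf_le1 // ler1n|].
  by rewrite errorE => hT; exists T.
exists (fun n => concept_of (T n)); split=> [n|].
  by exists (T n) => //; have [] := hT n.
apply: (@squeeze_cvge _ _ _ _ (fun=> 0%E) _ (fun n => (n.+1%:R^-1)%:E)).
- by apply: nearW => n; rewrite measure_ge0 /= setYC; have [] := hT n.
- exact: cvg_cst.
- by apply/cvg_EFin; [exact: nearW|exact: cvg_harmonic].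
Qed.

End Measure.

(** * Uniform interpretability, constant depth and closures *)

Theorem theorem8 (R : realType) (d : measure_display) (X : measurableType d)
    (H : set (set X)) (c : set X)
    (mH : forall h, H h -> measurable h) (mc : measurable c)
    (VC_applies : VC_theorem_applies R H c)
    (VC_H : finite_VC_dim H) :
  (uniformly_interpretable R H c <->
     (\bigcup_(k in [set k | (1 <= k)%N]) clos R (Alg H k)) c) /\
  (uniformly_interpretable_at_constant_depth R H c <->
     (\bigcup_(k in [set k | (1 <= k)%N]) clos R (Alg H k)) c).
Proof.
have const_unif : uniformly_interpretable_at_constant_depth R H c ->
    uniformly_interpretable R H c by move=> [k hk]; exists (fun=> k).
have clos_const : (\bigcup_(k in [set k | (1 <= k)%N]) clos R (Alg H k)) c ->
    uniformly_interpretable_at_constant_depth R H c.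
  by move=> [k _ /clos_interpretable hk]; exists k.
have gH := poly_growth_finite_VC_dim VC_H.
have unif_clos : uniformly_interpretable R H c ->
    (\bigcup_(k in [set k | (1 <= k)%N]) clos R (Alg H k)) c.
  move=> [f' /interpretable_weakly_learnable-/(_ 9)/(consistent_tree gH)[k hk]].
  (* The successor makes the depth index at least 1, as the union requires. *)
  exists k.+1 => //; apply: interpretable_clos => //.
  apply: VC_interpretable => // n x; have [T [bT dT hT]] := hk n x.
  by exists T; split => //; exact: leqW.
by split; split; auto.
Qed.
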